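(* Let $S_n=K_{1,n}$ be the star graph with $n$ leaves (one central vertex joined by an edge to each of $n$ other vertices). For all $n\ge 2$, the complex $\mathcal{SM}(S_n)$ of strong discrete Morse matchings on $S_n$ is contractible.
   Context: All simplicial complexes are finite. For a simplicial complex $K$ and a vertex $v$, the link $\mathrm{lk}(v,K)$ consists of the simplices $\sigma$ of $K$ with $v\notin\sigma$ and $\sigma\cup\{v\}\in K$. A vertex $v$ is dominated by a vertex $a\ne v$ in $K$ if $\mathrm{lk}(v,K)=a*K_0$ is a simplicial cone with apex $a$ (over a possibly empty subcomplex $K_0$). A vertex filtration is an injective map $g:V(K)\to\mathbb{R}$; $K_{g(v)}$ denotes the full subcomplex of $K$ on the vertices $w$ with $g(w)\le g(v)$. The vertex $v$ is descending dominated by $a$ if $v$ is dominated by $a$ in $K_{g(v)}$ (so $g(a)<g(v)$). A strong Morse matching associated with $g$ is obtained by choosing, for every descending dominated vertex $v$, one vertex $a_v$ dominating it in $K_{g(v)}$, and taking the set of all pairs $(\sigma,\sigma\cup\{a_v\})$ where $\sigma$ is a simplex of $K_{g(v)}$ with $v\in\sigma$ and $a_v\notin\sigma$; vertices that are not descending dominated contribute no pairs. A strong Morse matching on $K$ is one associated with some vertex filtration (and some choices). The complex $\mathcal{SM}(K)$ is the simplicial complex whose simplices are all nonempty subsets of strong Morse matchings on $K$ (so its vertices are the pairs $(\sigma,\tau)$, $\sigma$ a codimension-one face of $\tau$, occurring in some strong Morse matching). *)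

(* Defs.v *)
From mathcomp Require Import all_boot all_order all_algebra.
From mathcomp Require Import all_classical all_reals topology normedtype.

Set Implicit Arguments.
Unset Strict Implicit.
Unset Printing Implicit Defensive.

Import Order.TTheory GRing.Theory Num.Theory numFieldNormedType.Exports.

Local Open Scope classical_set_scope.
Local Open Scope ring_scope.

(* Simplices are nonempty, and an element v of V need not be a vertex: it is
   one exactly when [set v] is a simplex. *)
Definition is_complex (V : finType) (F : {set {set V}}) : bool :=
  (finset.set0 \notin F) &&
  [forall s in F, forall t : {set V},
     (t \subset s) && (t != finset.set0) ==> (t \in F)].

Record complex (V : finType) := Complex {
  simplices :> {set {set V}};
  complexP : is_complex simplices
}.

Section StrongMorse.
Variables (V : finType).
Implicit Types (F : {set {set V}}) (K : complex V) (v a : V).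

Definition vertices F : {set V} := [set v | [set v]%SET \in F]%SET.

Definition link v F : {set {set V}} :=
  [set s in F | (v \notin s) && (v |: s \in F)]%SET.

(* a itself is in the cone, as the join of the apex with the (suppressed)
   empty simplex. *)
Definition cone a F : {set {set V}} :=
  ([set [set a]] :|: F :|: [set a |: s | s : {set V} in F])%SET.

Definition dominated F v a : bool :=
  (a != v) &&
  [exists F0 : {set {set V}},
     [&& is_complex F0, a \notin vertices F0 & link v F == cone a F0]].

Definition is_filtration (R : realType) K (g : V -> R) : Prop :=
  {in vertices K &, injective g}.

Definition sublevel (R : realType) K (g : V -> R) (v : V) : {set {set V}} :=
  [set s in K | [forall w in s, g w <= g v]]%SET.

Definition descending_dominated (R : realType) K (g : V -> R) v : bool :=
  [exists a, dominated (sublevel K g v) v a].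

Definition is_dominating_choice (R : realType) K (g : V -> R) (c : V -> V) :
    Prop :=
  forall v, descending_dominated K g v -> dominated (sublevel K g v) v (c v).

Definition morse_matching (R : realType) K (g : V -> R) (c : V -> V) :
    {set {set V} * {set V}} :=
  [set p | [exists v, [&& descending_dominated K g v,
                          p.1 \in sublevel K g v, v \in p.1, c v \notin p.1
                        & p.2 == (c v |: p.1)%SET]]]%SET.

Definition is_strong_morse_matching (R : realType) K
    (M : {set {set V} * {set V}}) : Prop :=
  exists g : V -> R, exists c : V -> V,
    [/\ is_filtration K g, is_dominating_choice K g c
      & M = morse_matching K g c].

Definition SM_simplices (R : realType) K : {set {set {set V} * {set V}}} :=
  [set N | (N != finset.set0) &&
     `[< exists2 M : {set {set V} * {set V}},
           is_strong_morse_matching R K M & N \subset M >] ]%SET.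

Lemma SM_is_complex (R : realType) K : is_complex (SM_simplices R K).
Proof.
apply/andP; split; first by rewrite inE eqxx.
apply/forall_inP => s; rewrite inE => /andP[_ /asboolP[M MM sM]].
apply/forallP => t; apply/implyP => /andP[ts t0]; rewrite inE t0 /=.
by apply/asboolP; exists M => //; exact: fintype.subset_trans sM.
Qed.

Definition SM (R : realType) K : complex ({set V} * {set V})%type :=
  Complex (SM_is_complex R K).

End StrongMorse.

Section Star.
Variable n : nat.

(* None is the centre, Some i are the leaves. *)
Definition star_simplices : {set {set option 'I_n}} :=
  ([set [set x] | x : option 'I_n] :|:
   [set [set None; Some i] | i : 'I_n])%SET.

Lemma star_is_complex : is_complex star_simplices.
Proof.
apply/andP; split.
  rewrite inE negb_or; apply/andP; split; apply/negP.
    by case/imsetP => x _ /setP/(_ x); rewrite !inE eqxx.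
  by case/imsetP => i _ /setP/(_ None); rewrite !inE eqxx.
apply/forall_inP => s sS; apply/forallP => t.
apply/implyP => /andP[ts t0]; move: sS; rewrite !inE.
case/orP => /imsetP[x _ sE]; move: ts; rewrite {}sE.
  rewrite subset1 (negbTE t0) orbF => /eqP ->.
  by rewrite imset_f.
move/finset.setUidPr => tE.
have tin y : y \in t -> (y == None) || (y == Some x).
  by move=> yt; rewrite -in_set2 -tE inE yt.
case N: (None \in t); case S: (Some x \in t).
- apply/orP; right; apply/imsetP; exists x => //; apply/setP => y.
  by rewrite !inE; apply/idP/idP => [/tin //|/orP[]/eqP->].
- apply/orP; left; apply/imsetP; exists None => //; apply/setP => y.
  rewrite !inE; apply/idP/eqP => [yt|->//].
  by case/orP: (tin y yt) => /eqP yE //; rewrite -yE yt in S.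
- apply/orP; left; apply/imsetP; exists (Some x) => //; apply/setP => y.
  rewrite !inE; apply/idP/eqP => [yt|->//].
  by case/orP: (tin y yt) => /eqP yE //; rewrite -yE yt in N.
- case/set0Pn: t0 => y yt.
  by case/orP: (tin y yt) => /eqP yE; rewrite -yE yt in N S.
Qed.

Definition star : complex (option 'I_n) := Complex star_is_complex.

End Star.

(* As V is finite, this is the Euclidean space R^V. *)
Definition coordinate_space (R : realType) (V : finType) : topologicalType :=
  {ptws V -> R}.

Definition realization (R : realType) (V : finType) (K : complex V) :
    set (coordinate_space R V) :=
  [set t : V -> R | [/\ forall v, 0 <= t v, \sum_v t v = 1
             & [set v | t v != 0]%SET \in simplices K]].

Arguments realization R {V} K.

(* The subspace A of X is contractible: its identity map is homotopic, within
   A, to a constant map. *)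
Definition contractible (R : realType) (X : topologicalType) (A : set X) :
    Prop :=
  exists x0 : X, exists H : R * X -> X,
    [/\ A x0,
        {within `[0, 1]%classic `*` A, continuous H},
        forall t x, `[0, 1]%classic t -> A x -> A (H (t, x)),
        forall x, A x -> H (0, x) = x
      & forall x, A x -> H (1, x) = x0].

(* Main.v *)
Require Import Defs.
From mathcomp Require Import all_boot all_algebra all_reals.
From mathcomp Require Import all_order all_classical topology normedtype lra.

(* The vertices of SM(S_n) are y_j, matching the leaf j with its edge, and x_i,
   matching the centre with the edge of the leaf i.  The matching of a
   filtration g contains y_j when the centre comes before j, and it contains
   x_i when i is the only leaf before the centre; then it contains y_j for all
   j != i.  Hence the map sending x_i to some y_j with j != i and fixing each
   y_j is contiguous to the identity, and its image lies in the simplex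
   {y_1, ..., y_n}, the matching of a filtration that starts at the centre.
   Two straight-line homotopies, run one after the other, contract the
   realization. *)

Set Implicit Arguments.
Unset Strict Implicit.
Unset Printing Implicit Defensive.

Import Order.TTheory GRing.Theory Num.Theory numFieldNormedType.Exports.

(** * Contracting a realization by contiguous vertex maps *)

Section Realization.

Local Open Scope classical_set_scope.
Local Open Scope ring_scope.

(** The pointwise topology is the supremum of the initial topologies of the evaluations, so
    convergence can be checked for each [v] separately. *)
Lemma continuous_coordinates (R : realType) (V : finType) (T : topologicalType)
    (f : T -> coordinate_space R V) :
  (forall v, continuous (fun x => f x v)) -> continuous f.
Proof.
move=> fc x; apply/cvg_sup.
move=> v; move: x.
exact: (@continuous_comp_initial _ _ _ (fun t : V -> R => t v) f (fc v)).
Qed.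

(** Places a point in the realization without computing its exact support: [K] is closed under
    nonempty subsets, and coordinates of sum 1 cannot all vanish. *)
Lemma realization_support (R : realType) (V : finType) (K : complex V)
    (s : {set V}) (t : V -> R) :
  s \in simplices K -> (forall v, 0 <= t v) -> \sum_v t v = 1 ->
  (forall v, t v != 0 -> v \in s) -> realization R K t.
Proof.
move=> sK t0 t1 ts; split=> //.
case/andP: (complexP K) => _ /forall_inP/(_ s sK)/forallP/(_ _)/implyP; apply.
apply/andP; split; first by apply/fintype.subsetP => v; rewrite inE => /ts.
apply/eqP => supp0; have := oner_neq0 R; rewrite -t1 big1 ?eqxx// => v _.
by apply/eqP; have /setP/(_ v) := supp0; rewrite !inE => /negbFE.
Qed.

(** The second hypothesis makes [phi] contiguous to the identity, the third makes it contiguous to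
    the constant map [w]. Each contiguity keeps a segment inside one closed simplex. *)
Lemma contiguous_contractible (R : realType) (V : finType) (K : complex V)
    (phi : V -> V) (w : V) :
  [set w]%SET \in simplices K ->
  (forall s, s \in simplices K -> (s :|: phi @: s)%SET \in simplices K) ->
  (forall s, s \in simplices K -> (w |: phi @: s)%SET \in simplices K) ->
  contractible R (realization R K).
Proof.
move=> wK idK cK.
(* The affine extension of [phi] to barycentric coordinates. *)
pose push (t : V -> R) u := \sum_(v | phi v == u) t v.
pose p (s : R) := Num.max 0 (1 - 2 * s).
pose q (s : R) := Num.max 0 (2 * s - 1).
pose dw (v : V) : R := (v == w)%:R.
pose H (st : R * coordinate_space R V) : coordinate_space R V := fun v =>
  p st.1 * st.2 v + (1 - p st.1 - q st.1) * push st.2 v + q st.1 * dw v.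
have dw1 : \sum_v dw v = 1.
  by rewrite (bigD1 w)//= /dw eqxx big1 ?addr0// => v /negbTE ->.
have Kw : realization R K dw.
  apply: (realization_support wK) => // v.
  by rewrite /dw pnatr_eq0 eqb0 negbK inE.
exists dw, H; split=> //.
- apply: continuous_subspaceT; apply: continuous_coordinates => v.
  have c1 : continuous (fun st : R * coordinate_space R V => st.1).
    by move=> st; exact: cvg_fst.
  have c2 u : continuous (fun st : R * coordinate_space R V => st.2 u).
    move=> st.
    have cu : continuous (fun t : coordinate_space R V => t u).
      exact: (@proj_continuous V (fun=> R) u).
    have cs : {for st, continuous (@snd R (coordinate_space R V))}.
      exact: cvg_snd.
    exact: (continuous_comp cs (cu _)).
  have cmax (f : R -> R) : continuous f ->
      continuous (fun st : R * coordinate_space R V => Num.max 0 (f st.1)).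
    move=> cf st.
    have cm : {for st.1, continuous (fun z => Num.max 0 (f z) : R)}.
      exact: (continuous_max (@cst_continuous _ _ (0 : R^o) _) (cf st.1)).
    exact: (continuous_comp (c1 st) cm).
  have cp : continuous (fun st : R * coordinate_space R V => p st.1).
    apply: (cmax (fun z => 1 - 2 * z)) => z; apply: cvgB; first exact: cvg_cst.
    by apply: cvgM; [exact: cvg_cst|exact: cvg_id].
  have cq : continuous (fun st : R * coordinate_space R V => q st.1).
    apply: (cmax (fun z => 2 * z - 1)) => z; apply: cvgB; last exact: cvg_cst.
    by apply: cvgM; [exact: cvg_cst|exact: cvg_id].
  have cpush : continuous (fun st : R * coordinate_space R V => push st.2 v).
    by apply: continuous_big => [|u _]; [exact: add_continuous|exact: c2].
  have cr : continuous (fun st : R * coordinate_space R V =>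
      1 - p st.1 - q st.1).
    by move=> st; exact: (cvgB (cvgB (cvg_cst (1 : R)) (cp st)) (cq st)).
  move=> st; exact: (cvgD (cvgD (cvgM (cp st) (c2 v st))
    (cvgM (cr st) (cpush st))) (cvgM (cq st) (cvg_cst (dw v)))).
- move=> s t /=; rewrite in_itv/= => /andP[s0 s1] [t0 t1 tK].
  have push0 v : 0 <= push t v by exact: sumr_ge0.
  have push1 : \sum_v push t v = 1.
    by rewrite -t1 [RHS](partition_big phi predT).
  have pushS v : push t v != 0 -> v \in phi @: [set v | t v != 0]%SET.
    apply: contraR => vN; apply/eqP/big1 => u /eqP uv; apply/eqP.
    by apply: contraR vN => tu; rewrite -uv imset_f ?inE.
  (* At every time at most two of the three terms are present, so the support stays in one of the
     two unions given by the hypotheses. *)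
  have coef : [/\ 0 <= p s, 0 <= q s, 0 <= 1 - p s - q s
                & p s = 0 \/ q s = 0].
    rewrite /p /q; have [h|/ltW h] := lerP (2 * s) 1.
      rewrite max_r ?subr_ge0// max_l ?subr_le0//.
      by split; rewrite ?subr_ge0//; [lra|right].
    rewrite max_l ?subr_le0// max_r ?subr_ge0//.
    by split; rewrite ?subr_ge0//; [lra|left].
  case: coef => p0 q0 r0 pq.
  pose S : {set V} := if p s == 0 then (w |: phi @: [set v | t v != 0])%SET
           else ([set v | t v != 0] :|: phi @: [set v | t v != 0])%SET.
  apply: (@realization_support _ _ _ S).
  + by rewrite /S; case: ifP => _; [exact: cK|exact: idK].
  + by move=> v; rewrite /H /= !addr_ge0 ?mulr_ge0.
  + rewrite /H /= !big_split/= -!mulr_sumr t1 push1 dw1.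
    by rewrite !mulr1; lra.
  + move=> v; apply: contraR; rewrite /S /H /=.
    have [->|pn0] := eqVneq (p s) 0.
      rewrite finset.in_setU1 negb_or => /andP[vw /(contraNeq (pushS v)) ->].
      by rewrite /dw (negbTE vw) !(mul0r, mulr0) !addr0.
    have -> : q s = 0 by case: pq => // p00; rewrite p00 eqxx in pn0.
    rewrite finset.in_setU negb_or inE negbK.
    move=> /andP[/eqP -> /(contraNeq (pushS v)) ->].
    by rewrite !(mul0r, mulr0) !addr0.
- move=> t _; apply/funext => v; rewrite /H /=.
  have -> : p 0 = 1 by rewrite /p max_r; lra.
  have -> : q 0 = 0 by rewrite /q max_l; lra.
  by rewrite subrr subr0 !mul0r mul1r !addr0.
- move=> t _; apply/funext => v; rewrite /H /=.
  have -> : p 1 = 0 by rewrite /p max_l; lra.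
  have -> : q 1 = 1 by rewrite /q max_r; lra.
  by rewrite subr0 subrr !mul0r mul1r !add0r.
Qed.

End Realization.

(** * Domination and Morse matchings in the star *)

Section StarMatchings.

Local Open Scope ring_scope.

Lemma dominated_edge (V : finType) (F : {set {set V}}) v a :
  dominated F v a -> [set v; a]%SET \in F.
Proof.
case/andP=> _ /existsP[F0 /and3P[_ _ /eqP lE]].
have : [set a]%SET \in link v F by rewrite lE !inE eqxx.
by rewrite inE => /and3P[].
Qed.

(** A cone absorbs its apex. *)
Lemma dominated_link (V : finType) (F : {set {set V}}) v a s :
  dominated F v a -> s \in link v F -> (a |: s)%SET \in link v F.
Proof.
case/andP=> _ /existsP[F0 /and3P[_ _ /eqP ->]].
rewrite !inE -orbA => /or3P[/eqP ->|sF0|/imsetP[t tF0 ->]].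
- by rewrite finset.setUid eqxx.
- by rewrite imset_f ?orbT.
- by rewrite finset.setUA finset.setUid imset_f ?orbT.
Qed.

(** A single point is the cone over the empty complex. *)
Lemma dominated_link1 (V : finType) (F : {set {set V}}) v a :
  link v F = [set [set a]]%SET -> dominated F v a.
Proof.
move=> lE; apply/andP; split.
  have : [set a]%SET \in link v F by rewrite lE inE.
  by rewrite !inE eq_sym => /and3P[].
apply/existsP; exists finset.set0; rewrite lE /vertices !inE /cone.
rewrite imset0 !finset.setU0 eqxx !andbT.
by rewrite /is_complex inE; apply/forall_inP => s; rewrite inE.
Qed.

Variable n : nat.
Implicit Types (i j k : 'I_n) (s : {set option 'I_n}).

Lemma star_vertex (v : option 'I_n) : [set v]%SET \in star_simplices n.
Proof. by rewrite inE imset_f. Qed.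

Lemma star_edge i : [set None; Some i]%SET \in star_simplices n.
Proof. by rewrite inE [X in _ || X]imset_f ?orbT. Qed.

Lemma star_leaf s i : s \in star_simplices n -> Some i \in s ->
  s = [set Some i]%SET \/ s = [set None; Some i]%SET.
Proof.
rewrite inE => /orP[]/imsetP[x _ ->]; rewrite !inE => /eqP.
  by move=> ->; left.
by case=> ->; right.
Qed.

Lemma star_center s : s \in star_simplices n -> None \in s ->
  s = [set None]%SET \/ exists i, s = [set None; Some i]%SET.
Proof.
rewrite inE => /orP[]/imsetP[x _ ->]; rewrite !inE; last by right; exists x.
by move/eqP=> <-; left.
Qed.

Definition center_pair i : {set option 'I_n} * {set option 'I_n} :=
  ([set None], [set None; Some i])%SET.

Definition leaf_pair j : {set option 'I_n} * {set option 'I_n} :=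
  ([set Some j], [set None; Some j])%SET.

Variables (R : realType) (g : option 'I_n -> R).
Variable (c : option 'I_n -> option 'I_n).

Lemma mem_sublevel v s : s \in sublevel (star n) g v =
  (s \in star_simplices n) && [forall w in s, g w <= g v].
Proof. by rewrite inE. Qed.

Lemma dominated_leaf j a :
  dominated (sublevel (star n) g (Some j)) (Some j) a ->
  a = None /\ g None <= g (Some j).
Proof.
move=> d; have := dominated_edge d.
rewrite mem_sublevel => /andP[sS /forall_inP gle].
have aE : a = None.
  case/andP: d => aj _; case: (@star_leaf _ j sS); first by rewrite !inE eqxx.
    by move/setP/(_ a); rewrite !inE eqxx orbT (negbTE aj).
  move/setP/(_ a); rewrite !inE eqxx orbT (negbTE aj) orbF.
  by move/esym/eqP.
by split=> //; apply: gle; rewrite aE !inE orbT.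
Qed.

(** If another leaf [k] were present, the cone with apex [i] would contain the set of both leaves,
    but no simplex of the star contains two leaves. *)
Lemma dominated_center a :
  dominated (sublevel (star n) g None) None a ->
  exists i, a = Some i /\ forall k, g (Some k) <= g None -> k = i.
Proof.
case: a => [i|] d; last by case/andP: d; rewrite eqxx.
exists i; split=> // k gk.
have : [set Some k]%SET \in link None (sublevel (star n) g None).
  rewrite inE !mem_sublevel star_vertex star_edge !inE /=.
  apply/andP; split; first by apply/forall_inP => w; rewrite inE => /eqP->.
  by apply/forall_inP => w; rewrite !inE => /orP[]/eqP->.
move=> /(dominated_link d); rewrite inE => /andP[+ _].
rewrite mem_sublevel => /andP[sS _].
have ks : Some k \in (Some i |: [set Some k])%SET by rewrite !inE eqxx orbT.
have [] := star_leaf sS ks => /setP/(_ (Some i)).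
  by rewrite !inE eqxx /= => /esym/eqP[->].
by rewrite !inE eqxx /= => /esym/eqP[->].
Qed.

Hypothesis c_dom : is_dominating_choice (star n) g c.

(** A leaf is dominated only by the centre, so its one matched simplex is itself. At the centre, an
    edge in the sublevel complex already contains the dominating leaf, so only the centre itself is
    matched. *)
Lemma mem_morse_matching p : p \in morse_matching (star n) g c ->
  (exists2 j, p = leaf_pair j & g None <= g (Some j)) \/
  (exists2 i, p = center_pair i & forall k, g (Some k) <= g None -> k = i).
Proof.
case: p => p1 p2; rewrite inE.
move=> /existsP[v /and5P[/c_dom dv /= p1S vp1 cvp1 /eqP ->]].
move: p1S; rewrite mem_sublevel => /andP[p1S /forall_inP p1g].
case: v => [j|] in dv vp1 p1g cvp1 *.
  left; exists j; case: (dominated_leaf dv) => // cv _.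
  have [p1E|p1E] := star_leaf p1S vp1; first by rewrite p1E cv.
  by rewrite p1E cv !inE eqxx in cvp1.
right; have [i [ci ik]] := dominated_center dv; exists i => //.
have [->|[k p1E]] := star_center p1S vp1.
  by rewrite ci finset.setUC.
have ki : k = i by apply: ik; apply: p1g; rewrite p1E !inE eqxx orbT.
by rewrite p1E ci ki !inE eqxx orbT in cvp1.
Qed.

Lemma leaf_pair_matching j : g None < g (Some j) ->
  leaf_pair j \in morse_matching (star n) g c.
Proof.
move=> gj.
have jj : descending_dominated (star n) g (Some j).
  (* The link of the leaf [j] consists of the centre alone. *)
  apply/existsP; exists None; apply: dominated_link1; apply/setP => s.
  rewrite finset.in_set1 inE !mem_sublevel; apply/idP/eqP.
    case/and3P=> /andP[sS _] js /andP[jsS _].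
    have sN x : x \in s -> x = None.
      move=> xs; have xjs : x \in (Some j |: s)%SET by rewrite !inE xs orbT.
      have xj : (x == Some j) = false by apply: contraNF js => /eqP <-.
      case: (star_leaf jsS (setU11 _ _)) => E; move: xjs.
        by rewrite E !inE xj.
      rewrite E !inE xj orbF.
      by move/eqP.
    move: sS; rewrite inE => /orP[]/imsetP[x _ sE].
      by rewrite sE (sN x)// sE inE.
    by have := sN (Some x); rewrite sE !inE eqxx orbT => /(_ isT).
  move=> ->; rewrite star_vertex finset.setUC star_edge !inE /=.
  apply/andP; split; apply/forall_inP => w; rewrite !inE.
    by move/eqP->; exact: ltW.
  by move/orP=> []/eqP->//; exact: ltW.
rewrite inE; apply/existsP; exists (Some j).
(* The value of [c] at a leaf is forced, so the pair occurs whatever the choice. *)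
have [cj _] := dominated_leaf (c_dom jj).
rewrite jj cj mem_sublevel star_vertex !inE !eqxx /= andbT.
by apply/forall_inP => w; rewrite inE => /eqP->.
Qed.

(** Every leaf other than [i] lies strictly above the centre once the centre is dominated by [i]. *)
Lemma center_pair_matching i j :
  center_pair i \in morse_matching (star n) g c -> j != i ->
  leaf_pair j \in morse_matching (star n) g c.
Proof.
move=> /mem_morse_matching[[k /(congr1 fst)/setP/(_ None)]|[k pE before] ji].
  by rewrite !inE.
have [ki] : Some k = Some i.
  by move/(congr1 snd)/setP/(_ (Some k)): pE; rewrite !inE !eqxx /= => /eqP.
apply: leaf_pair_matching; rewrite ltNge.
by apply: contra ji => /before ->; rewrite ki.
Qed.

End StarMatchings.

(** * Simplices of the matching complex and its contraction *)

Section StrongMorseComplex.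

Local Open Scope ring_scope.

Lemma SMP (R : realType) (V : finType) (K : complex V)
    (N : {set {set V} * {set V}}) :
  N \in simplices (SM R K) <->
  N != finset.set0 /\ exists g : V -> R, exists c : V -> V,
    [/\ is_filtration K g, is_dominating_choice K g c
      & N \subset morse_matching K g c].
Proof.
rewrite inE; split=> [/andP[N0 /asboolP[M [g [c [gK cK ->]]] NM]]|].
  by split=> //; exists g, c.
move=> [-> [g [c [gK cK NM]]]]; apply/asboolP.
by exists (morse_matching K g c) => //; exists g, c.
Qed.

Lemma dominating_choice (R : realType) (V : finType) (K : complex V)
    (g : V -> R) : exists c, is_dominating_choice K g c.
Proof.
(* The default [v] is taken only where nothing dominates [v]. *)
exists (fun v => odflt v [pick a | dominated (sublevel K g v) v a]).
move=> v /existsP[a da]; case: pickP => //= da0.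
by rewrite da0 in da.
Qed.

Lemma leaf_pairs_SM (R : realType) n
    (N : {set {set option 'I_n} * {set option 'I_n}}) :
  N != finset.set0 -> {in N, forall p, exists j, p = leaf_pair j} ->
  N \in simplices (SM R (star n)).
Proof.
move=> N0 Nleaf; apply/SMP; split=> //.
(* The successor keeps leaf 0 strictly above the centre, so this one filtration matches every leaf
   with its edge. *)
pose g (v : option 'I_n) : R := if v is Some i then (val i).+1%:R else 0.
have [c cg] := dominating_choice (star n) g; exists g, c; split=> //.
  move=> [i|] [j|] _ _ //= /eqP;
    rewrite ?eqr_nat ?pnatr_eq0 // 1?eq_sym ?pnatr_eq0 //.
  by rewrite eqSS => /eqP/val_inj ->.
apply/fintype.subsetP => p /Nleaf[j ->].
by apply: leaf_pair_matching => //; rewrite /g ltr0n.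
Qed.

End StrongMorseComplex.

Theorem theorem7p1 (R : realType) (n : nat) (hn : 2 <= n) :
  contractible R (realization R (SM R (star n))).
Proof.
(* Two distinct leaves exist because [n] is at least 2, so a leaf different from any given [i] can
   be chosen. *)
pose i0 : 'I_n := Ordinal (ltnW hn); pose i1 : 'I_n := Ordinal hn.
pose other (i : 'I_n) := if i == i0 then i1 else i0.
have otherN i : other i != i.
  by rewrite /other; case: (eqVneq i i0) => [->|] //; rewrite eq_sym.
pose phi (p : {set option 'I_n} * {set option 'I_n}) :=
  if [pick i | p == center_pair i] is Some i then leaf_pair (other i) else p.
(* The pairs [p] and [phi p] lie in the matching of the same [g] and [c]; this is what makes [phi]
   contiguous to the identity. *)
have phiP (g : option 'I_n -> R) c p : is_dominating_choice (star n) g c ->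
    p \in morse_matching (star n) g c ->
    phi p \in morse_matching (star n) g c /\ exists j, phi p = leaf_pair j.
  move=> cK pM; rewrite /phi; case: pickP => [i /eqP pE|pN].
    split; last by exists (other i).
    by apply: (center_pair_matching cK _ (otherN i)); rewrite -pE.
  split=> //; case: (mem_morse_matching cK pM) => -[j pE _]; first by exists j.
  by have := pN j; rewrite pE eqxx.
apply: (@contiguous_contractible R _ _ phi (leaf_pair i0)).
- apply: leaf_pairs_SM => [|p]; last by rewrite inE => /eqP ->; exists i0.
  by apply/set0Pn; exists (leaf_pair i0); rewrite inE.
- move=> s /SMP[/set0Pn[p ps] [g [c [gK cK /fintype.subsetP sM]]]].
  apply/SMP; split; first by apply/set0Pn; exists p; rewrite inE ps.
  exists g, c; split=> //; rewrite finset.subUset; apply/andP; split.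
    exact/fintype.subsetP.
  apply/fintype.subsetP => _ /imsetP[q qs ->].
  by case: (phiP g c q cK (sM _ qs)).
(* Here the matching containing [s] is abandoned: all pairs in question are leaf pairs, and these
   span a simplex. *)
- move=> s /SMP[_ [g [c [gK cK /fintype.subsetP sM]]]].
  apply: leaf_pairs_SM => [|p].
    by apply/set0Pn; exists (leaf_pair i0); exact: setU11.
  rewrite finset.in_setU1 => /orP[/eqP ->|/imsetP[q qs ->]]; first by exists i0.
  by case: (phiP g c q cK (sM _ qs)).
Qed.
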